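(* Let $\alpha\in\mathbb{R}$ be transcendental over $\mathbb{Q}$. Identify each element of $\mathbb{Q}(\alpha)$ with the unique rational function $r\in\mathbb{Q}(x)$ such that the element equals $r(\alpha)$, let $\mathbb{Q}(\alpha)^+$ be the set of those $r$ with $r(\alpha)>0$, and define $H_+=\{r\in \mathbb{Q}(\alpha)^+ : r'(\alpha)>0\}$, $H_0=\{r\in \mathbb{Q}(\alpha)^+ : r'(\alpha)=0\}$, $H_-=\{r\in \mathbb{Q}(\alpha)^+ : r'(\alpha)<0\}$. Then the only ways to write $\mathbb{Q}(\alpha)^+=A\sqcup B$ (unordered) with $A,B$ disjoint nonempty subsets each closed under addition and multiplication are $\mathbb{Q}(\alpha)^+=(H_+\cup H_0)\sqcup H_-$ and $\mathbb{Q}(\alpha)^+=H_+\sqcup(H_0\cup H_-)$. *)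

(* Defs.v *)
From HB Require Import structures.
From mathcomp Require Import all_boot all_order all_algebra.
From mathcomp Require Import generic_quotient fraction.
From mathcomp Require Import reals.
Set Implicit Arguments. Unset Strict Implicit. Unset Printing Implicit Defensive.
Import Order.TTheory GRing.Theory Num.Theory.
Local Open Scope ring_scope.

Definition ratfun := {fraction {poly rat}}.

Definition peval (R : realType) (a : R) (p : {poly rat}) : R :=
  (map_poly (@ratr R) p).[a].

Definition transcendental (R : realType) (a : R) : Prop :=
  forall p : {poly rat}, p != 0 -> peval a p != 0.

Definition fnum (r : ratfun) : {poly rat} := \n_(repr r).
Definition fden (r : ratfun) : {poly rat} := \d_(repr r).

Definition feval (R : realType) (a : R) (r : ratfun) : R :=
  peval a (fnum r) / peval a (fden r).

Definition fderiv_at (R : realType) (a : R) (r : ratfun) : R :=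
  peval a ((fnum r)^`() * fden r - fnum r * (fden r)^`())
  / (peval a (fden r)) ^+ 2.

Definition Qpos (R : realType) (a : R) (r : ratfun) : Prop := 0 < feval a r.
Definition Hp (R : realType) (a : R) (r : ratfun) : Prop :=
  Qpos a r /\ 0 < fderiv_at a r.
Definition H0 (R : realType) (a : R) (r : ratfun) : Prop :=
  Qpos a r /\ fderiv_at a r = 0.
Definition Hm (R : realType) (a : R) (r : ratfun) : Prop :=
  Qpos a r /\ fderiv_at a r < 0.

Definition semiring_closed_set (A : ratfun -> Prop) : Prop :=
  (forall r s, A r -> A s -> A (r + s)) /\ (forall r s, A r -> A s -> A (r * s)).

Definition good_split (R : realType) (a : R) (A B : ratfun -> Prop) : Prop :=
  [/\ forall r, Qpos a r <-> (A r \/ B r),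
      forall r, ~ (A r /\ B r),
      (exists r, A r) /\ (exists r, B r)
    & semiring_closed_set A /\ semiring_closed_set B].

Definition same_set (A B : ratfun -> Prop) : Prop := forall r, A r <-> B r.

(* Main.v *)
Require Import Defs.
From HB Require Import structures.
From mathcomp Require Import all_boot all_order all_algebra.
From mathcomp Require Import generic_quotient fraction.
From mathcomp Require Import reals.
From mathcomp Require Import ring lra.
Import Order.TTheory GRing.Theory Num.Theory.
Local Open Scope ring_scope.

(* Say that 1 lies in A. Then A contains the positive rationals, and an
   argument with b^2 + c shows that B is stable under adding positive
   rationals, so that A and B extend to a partition of the field into two
   Q-cones invariant under rational translation. If alpha and -alpha both lie
   in the cone of A, so do all polynomials in alpha, which forces B to be empty.
   Otherwise t = alpha or t = -alpha lies in the cone of B, and comparing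
   elements with rational multiples of t assigns to every polynomial in alpha
   a slope; multiplying elements of A or of B close to 0 gives the Leibniz
   rule, so the slope is +- the derivative at alpha. A quotient n/d is
   reduced to this by multiplying n and d with a linear polynomial m such that
   (n m)' and (d m)' have opposite signs; and r'(alpha) = 0 makes r constant. *)

(** * Rational approximation of reals *)

Lemma rat_between (R : realType) (x y : R) :
  x < y -> exists2 q : rat, x < ratr q & ratr q < y.
Proof.
move=> /rat_in_itvoo[q]; rewrite inE /= => /andP[xq qy].
by exists q.
Qed.

(* With [m = u + c x]: [m(a)] is close to [1], and [c] lies strictly between
   [- N' / N] and [- D' / D]. *)
Lemma affine_separation (R : realType) (a N N' D D' : R) :
  0 < N -> 0 < D -> N * D' < N' * D ->
  exists u c : rat, [/\ 0 < ratr u + ratr c * a,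
    0 < N' * (ratr u + ratr c * a) + ratr c * N &
    D' * (ratr u + ratr c * a) + ratr c * D < 0].
Proof.
move=> N0 D0 ND.
have [c Nc cD] : exists2 c : rat, - N' / N < ratr c & ratr c < - D' / D.
  by apply: rat_between; rewrite ltr_pdivrMr // mulrAC ltr_pdivlMr //; lra.
move: Nc cD; rewrite (ltr_pdivrMr _ _ N0) (ltr_pdivlMr _ _ D0) => Nc cD.
set P := N' + ratr c * N; set Q := - (D' + ratr c * D).
have P0 : 0 < P by rewrite /P; lra.
have Q0 : 0 < Q by rewrite /Q; lra.
(* At [h = 1] the two inequalities hold with margins [P] and [Q]. As [M] bounds [|N'|] and [|D'|],
   moving [h] by less than [min P Q / M] preserves them. *)
pose M := `|N'| + `|D'| + 1.
have M0 : 0 < M by rewrite /M ltr_wpDl // addr_ge0.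
have [u ua au] : exists2 u : rat, 1 - ratr c * a < ratr u &
    ratr u < 1 - ratr c * a + Num.min P Q / M.
  by apply: rat_between; rewrite ltrDl divr_gt0 // lt_min P0.
exists u, c; set h := ratr u + ratr c * a.
have h1 : 0 < h - 1 by rewrite /h; lra.
have : h - 1 < Num.min P Q / M by rewrite /h; lra.
rewrite ltr_pdivlMr // lt_min => /andP[hP hQ].
have := normr_ge0 N'; have := normr_ge0 D'.
have := ler_norm D'; have := ler_norm (- N'); rewrite normrN => N1 D1 D2 N2.
have hN : - N' * (h - 1) <= (h - 1) * M.
  by rewrite mulrC ler_pM2l // /M; lra.
have hD : D' * (h - 1) <= (h - 1) * M.
  by rewrite mulrC ler_pM2l // /M; lra.
rewrite /P in hP; rewrite /Q in hQ; split; lra.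
Qed.

(** * Splits of the positive part of a field embedded in the reals *)

Section Split.
Variables (R : realType) (K : fieldType).
Variables (v : {rmorphism K -> R}) (iota : {rmorphism rat -> K}).
Variables A B : K -> Prop.
Hypothesis cover : forall z, 0 < v z <-> (A z \/ B z).
Hypothesis disj : forall {z}, A z -> B z -> False.
Hypothesis addA : forall x y, A x -> A y -> A (x + y).
Hypothesis mulA : forall x y, A x -> A y -> A (x * y).
Hypothesis addB : forall x y, B x -> B y -> B (x + y).
Hypothesis mulB : forall x y, B x -> B y -> B (x * y).
Hypothesis oneA : A 1.

(** * Positive rationals acting on [A] and [B], and the translation-invariant cones *)

Lemma v_iota q : v (iota q) = ratr q.
Proof. exact: (fmorph_eq_rat (v \o iota)). Qed.

Lemma posA {z} : A z -> 0 < v z.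
Proof. by move=> Az; apply/cover; left. Qed.

Lemma posB {z} : B z -> 0 < v z.
Proof. by move=> Bz; apply/cover; right. Qed.

Lemma notA_B {z} : 0 < v z -> ~ A z -> B z.
Proof. by move=> /cover[]. Qed.

Lemma notB_A {z} : 0 < v z -> ~ B z -> A z.
Proof. by move=> /cover[]. Qed.

(** If [1 / (n + 1)] were in [B], then adding it [n + 1] times would put [1] in [B]. *)
Lemma rat_inA q : 0 < q -> A (iota q).
Proof.
have natA n : A (iota n.+1%:R).
  elim: n => [|n IH]; first by rewrite rmorph1.
  by rewrite -natr1 rmorphD rmorph1; apply: addA.
have invA n : A (iota n.+1%:R^-1).
  apply: notB_A; first by rewrite v_iota ltr0q invr_gt0.
  move=> Bi; have Bm m : B (iota (m.+1%:R / n.+1%:R)).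
    elim: m => [|m IH]; first by rewrite mul1r.
    by rewrite -natr1 mulrDl mul1r rmorphD; apply: addB.
  apply: (disj oneA); rewrite -(rmorph1 iota).
  by have := Bm n; rewrite divff // pnatr_eq0.
move=> q0; rewrite -[q]divq_num_den rmorphM.
move: q0; rewrite -numq_gt0; case: (numq q) => [[|n]|n] // _.
have := denq_gt0 q; case: (denq q) => [[|m]|m] // _.
exact: mulA (natA n) (invA m).
Qed.

Lemma scaleA q z : 0 < q -> A z -> A (iota q * z).
Proof. by move=> q0 Az; apply: mulA => //; apply: rat_inA. Qed.

Lemma scaleB q z : 0 < q -> B z -> B (iota q * z).
Proof.
move=> q0 Bz; apply: notA_B.
  by rewrite rmorphM v_iota mulr_gt0 ?ltr0q ?posB.
move=> Aqz; apply: (disj _ Bz).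
have -> : z = iota q^-1 * (iota q * z).
  by rewrite mulrA -rmorphM mulVf ?gt_eqF // rmorph1 mul1r.
by apply: scaleA => //; rewrite invr_gt0.
Qed.

Lemma subB b q : B b -> 0 < q -> ratr q < v b -> B (b - iota q).
Proof.
move=> Bb q0 qb; apply: notA_B; first by rewrite rmorphB v_iota subr_gt0.
by move=> /addA/(_ (rat_inA _ q0)); rewrite subrK => /disj; apply.
Qed.

Lemma complB b q : B b -> v b < ratr q -> A (iota q - b).
Proof.
move=> Bb bq; apply: notB_A; first by rewrite rmorphB v_iota subr_gt0.
move=> /addB/(_ Bb); rewrite subrK; apply: disj; apply: rat_inA.
by rewrite -(ltr0q R); apply: lt_trans bq; apply: posB.
Qed.

(* [b^2 + c = (b - k)(b - l) + (k + l) b] for [c = k l] with [k, l < b]. *)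
Lemma sqr_addB b c : B b -> 0 < c -> ratr c < v b ^+ 2 -> B (b ^+ 2 + iota c).
Proof.
move=> Bb c0 cb; have b0 := posB Bb.
have rc0 : 0 < ratr c :> R by rewrite ltr0q.
have [k ck kb] : exists2 k : rat, ratr c / v b < ratr k & ratr k < v b.
  by apply: rat_between; rewrite ltr_pdivrMr -?expr2.
have rk0 : 0 < ratr k :> R by apply: lt_trans ck; apply: divr_gt0.
have k0 : 0 < k by rewrite ltr0q in rk0.
have l0 : 0 < c / k by apply: divr_gt0.
have -> : b ^+ 2 + iota c =
    (b - iota k) * (b - iota (c / k)) + iota (k + c / k) * b.
  have -> : iota c = iota (c / k) * iota k by rewrite -rmorphM divfK ?gt_eqF.
  ring.
apply: addB; first apply: mulB.
- exact: subB.
- apply: subB => //; rewrite fmorph_div ltr_pdivrMr //.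
  by move: ck; rewrite ltr_pdivrMr // mulrC.
- by apply: scaleB => //; apply: addr_gt0.
Qed.

(* Otherwise [(b + d)^2 + 2 d (j - b) = b^2 + (d^2 + 2 d j)] lies in [A] for
   every rational [j > b], against [sqr_addB]. *)
Lemma small_addB b d : B b -> 0 < d -> 3 * ratr d < v b -> B (b + iota d).
Proof.
move=> Bb d0 db; have b0 := posB Bb.
have rd0 : 0 < ratr d :> R by rewrite ltr0q.
apply: notA_B; first by rewrite rmorphD v_iota addr_gt0.
move=> Abd.
have [j bj jb] : exists2 j : rat, v b < ratr j & ratr j < v b + ratr d.
  by apply: rat_between; rewrite ltrDl.
have rj0 : 0 < ratr j :> R by apply: lt_trans bj.
have j0 : 0 < j by rewrite ltr0q in rj0.
apply: (@disj (b ^+ 2 + iota (d ^+ 2 + 2 * d * j))).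
  have -> : b ^+ 2 + iota (d ^+ 2 + 2 * d * j) =
    (b + iota d) * (b + iota d) + iota (2 * d) * (iota j - b) by ring.
  apply: addA; first exact: mulA.
  by apply: scaleA; [apply: mulr_gt0|apply: complB].
apply: sqr_addB => //.
  by rewrite addr_gt0 ?exprn_gt0 ?mulr_gt0.
(* With [b] read as its value, [d^2 + 2 d j < d^2 + 2 d (b + d) = b^2 - (b - 3 d) (b + d)]; this is
   where the factor [3] comes from. *)
rewrite rmorphD rmorphXn /= !rmorphM /= ratr_nat; nra.
Qed.

(** [q] is added in [n] equal steps, each below a third of [v b]; the value only grows on the way,
    so [small_addB] applies every time. *)
Lemma addB_rat b q : B b -> 0 < q -> B (b + iota q).
Proof.
move=> Bb q0; have b0 := posB Bb.
have [d d0 db] : exists2 d : rat, 0 < ratr d :> R & ratr d < v b / 3.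
  by apply: rat_between; apply: divr_gt0.
have rd0 : 0 < d by rewrite ltr0q in d0.
pose n := Num.bound (q / d).
have nq : q / d < n%:R by apply: archi_boundP; rewrite ltW ?divr_gt0.
have n0 : 0 < n%:R :> rat by apply: lt_trans nq; apply: divr_gt0.
have qn0 : 0 < q / n%:R by apply: divr_gt0.
have qnb : 3 * ratr (q / n%:R) < v b :> R.
  have : ratr (q / n%:R) < ratr d :> R.
    by rewrite ltr_rat ltr_pdivrMr // mulrC -ltr_pdivrMr.
  lra.
have step m : B (b + iota (m%:R * (q / n%:R))).
  elim: m => [|m IH]; first by rewrite mul0r rmorph0 addr0.
  rewrite -natr1 mulrDl mul1r rmorphD addrA; apply: small_addB => //.
  rewrite rmorphD v_iota; apply: (lt_le_trans qnb).
  by rewrite lerDl ler0q mulr_ge0 ?ler0n // ltW.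
by have := step n; rewrite mulrCA divff ?gt_eqF // mulr1.
Qed.

(* [As] and [Bs] are the Q-translation closures of [A] and [B]; they split
   all of [K] and behave like "derivative [<= 0]" and "derivative [> 0]". *)
Definition As z := exists q, A (z + iota q).
Definition Bs z := exists q, B (z + iota q).

(** Two translates differ by a rational: [subB] lowers and [addB_rat] raises the one known to lie in
    [B]. This is what makes [As] and [Bs] disjoint. *)
Lemma Bs_B z q : Bs z -> 0 < v z + ratr q -> B (z + iota q).
Proof.
case=> p Bp zq; have [qp|pq|->//] := ltgtP q p.
  have -> : z + iota q = z + iota p - iota (p - q) by ring.
  apply: subB; rewrite ?subr_gt0 // rmorphD v_iota rmorphB /=; lra.
have -> : z + iota q = z + iota p + iota (q - p) by ring.
by apply: addB_rat; rewrite ?subr_gt0.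
Qed.

Lemma AsBs {z} : As z -> Bs z -> False.
Proof.
case=> p Ap /Bs_B Bp; apply: (disj Ap); apply: Bp.
by rewrite -v_iota -rmorphD posA.
Qed.

Lemma As_A z q : As z -> 0 < v z + ratr q -> A (z + iota q).
Proof.
move=> Az zq; apply: notB_A => [|Bz]; first by rewrite rmorphD v_iota.
by apply: (AsBs Az); exists q.
Qed.

Lemma As_or_Bs z : As z \/ Bs z.
Proof.
have [q zq _] : exists2 q : rat, - v z < ratr q & ratr q < - v z + 1.
  by apply: rat_between; rewrite ltrDl.
have : 0 < v (z + iota q) by rewrite rmorphD v_iota; lra.
by move=> /cover[]; [left|right]; exists q.
Qed.

Lemma notBs z : ~ Bs z -> As z.
Proof. by case: (As_or_Bs z). Qed.

Lemma notAs z : ~ As z -> Bs z.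
Proof. by case: (As_or_Bs z). Qed.

Lemma A_As {z} : A z -> As z.
Proof. by exists 0; rewrite rmorph0 addr0. Qed.

Lemma B_Bs {z} : B z -> Bs z.
Proof. by exists 0; rewrite rmorph0 addr0. Qed.

Lemma As_A0 z : As z -> 0 < v z -> A z.
Proof. by move=> Hz; have := As_A _ 0 Hz; rewrite !rmorph0 !addr0; apply. Qed.

Lemma Bs_B0 z : Bs z -> 0 < v z -> B z.
Proof. by move=> Hz; have := Bs_B _ 0 Hz; rewrite !rmorph0 !addr0; apply. Qed.

Lemma AsD x y : As x -> As y -> As (x + y).
Proof.
move=> [p Ap] [q Aq]; exists (p + q).
by have := addA _ _ Ap Aq; rewrite addrACA rmorphD.
Qed.

Lemma BsD x y : Bs x -> Bs y -> Bs (x + y).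
Proof.
move=> [p Bp] [q Bq]; exists (p + q).
by have := addB _ _ Bp Bq; rewrite addrACA rmorphD.
Qed.

Lemma AsZ q z : 0 < q -> As z -> As (iota q * z).
Proof.
by move=> q0 [p /(scaleA _ _ q0)]; rewrite mulrDr -rmorphM; exists (q * p).
Qed.

Lemma BsZ q z : 0 < q -> Bs z -> Bs (iota q * z).
Proof.
by move=> q0 [p /(scaleB _ _ q0)]; rewrite mulrDr -rmorphM; exists (q * p).
Qed.

Lemma As_rat q : As (iota q).
Proof.
by exists (1 - q); rewrite -rmorphD addrC subrK rmorph1.
Qed.

(** Otherwise [0 = z + (- z)] would lie in [Bs], but rationals lie in [As]. *)
Lemma BsN z : Bs z -> As (- z).
Proof.
move=> Bz; apply: notBs => /(BsD _ _ Bz); rewrite subrr -(rmorph0 iota).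
by apply: AsBs; apply: As_rat.
Qed.

Lemma BsDA z w : Bs z -> As (- w) -> Bs (z + w).
Proof.
move=> Bz Aw; apply: notAs => Azw; apply: (AsBs _ Bz).
by have := AsD _ _ Azw Aw; rewrite addrK.
Qed.

(** The lineality space of the cone [As], a substitute for the elements of zero derivative. *)
Definition As2 z := As z /\ As (- z).

Lemma As2_rat q : As2 (iota q).
Proof. by split; rewrite -?rmorphN; apply: As_rat. Qed.

Lemma As2D x y : As2 x -> As2 y -> As2 (x + y).
Proof. by move=> [x1 x2] [y1 y2]; split; rewrite ?opprD; apply: AsD. Qed.

Lemma As2N x : As2 x -> As2 (- x).
Proof. by case=> ? ?; split; rewrite ?opprK. Qed.

Lemma As2Z q x : As2 x -> As2 (iota q * x).
Proof.
have pos p y : 0 < p -> As2 y -> As2 (iota p * y).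
  by move=> p0 [y1 y2]; split; rewrite -?mulrN; apply: AsZ.
move=> x2; have [q0|q0|->] := ltgtP q 0.
- by rewrite -mulrNN -rmorphN; apply: pos; [lra|apply: As2N].
- exact: pos.
- by rewrite rmorph0 mul0r -(rmorph0 iota); apply: As2_rat.
Qed.

(** Rational shifts bring both factors into [A], which is closed under products; the correction is a
    rational combination of [1] and the two factors, so it stays in [As2]. *)
Lemma As2M x y : As2 x -> As2 y -> As2 (x * y).
Proof.
have half a b : As2 a -> As2 b -> As (a * b).
  move=> a2 b2.
  have [p ap _] : exists2 p : rat, - v a < ratr p & ratr p < - v a + 1.
    by apply: rat_between; rewrite ltrDl.
  have [q bq _] : exists2 q : rat, - v b < ratr q & ratr q < - v b + 1.
    by apply: rat_between; rewrite ltrDl.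
  have aA : A (a + iota p) by apply: As_A a2.1 _; lra.
  have bA : A (b + iota q) by apply: As_A b2.1 _; lra.
  have -> : a * b = (a + iota p) * (b + iota q) +
     (iota (- q) * a + iota (- p) * b + iota (- (p * q))) by ring.
  apply: AsD; first by apply: A_As; apply: mulA.
  by apply: proj1; apply: As2D; [apply: As2D; apply: As2Z|apply: As2_rat].
move=> x2 y2; split; first exact: half.
by rewrite -mulNr; apply: half => //; apply: As2N.
Qed.

(* If [r] were in [B], then the product [(j - r) (d - c - e r)] of elements of
   [A] would make [e r^2 + (c - j e) r] an element of [As] and of [Bs]. *)
Lemma As2_quotient r d : 0 < v r -> 0 < v d -> As2 d -> As2 (r * d) -> A r.
Proof.
move=> r0 d0 dP rdP; apply: notB_A => // Br.
have [c c0 cd] : exists2 c : rat, 0 < ratr c :> R & ratr c < v d.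
  exact: rat_between.
have [j rj _] : exists2 j : rat, v r < ratr j & ratr j < v r + 1.
  by apply: rat_between; rewrite ltrDl.
have j0 : 0 < ratr j :> R by lra.
(* The first bound makes [c - j e] positive, the second makes [d - c - e r] positive. *)
have [e e0 ee] : exists2 e : rat, 0 < ratr e :> R &
    ratr e < Num.min (ratr c / ratr j) ((v d - ratr c) / v r).
  by apply: rat_between; rewrite lt_min; apply/andP; split;
    apply: divr_gt0; rewrite ?subr_gt0.
move: ee; rewrite lt_min (ltr_pdivlMr _ _ j0) (ltr_pdivlMr _ _ r0).
move=> /andP[ej er].
have e0' : 0 < e by rewrite ltr0q in e0.
have cje : 0 < c - j * e.
  by rewrite -(ltr0q R) rmorphB rmorphM /=; lra.
have jA : A (iota j - r) by apply: complB.
have dA : A (d - iota c - iota e * r).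
  apply: As_A0; last by rewrite !rmorphB rmorphM !v_iota; lra.
  apply: AsD; first by apply: (As2D _ _ dP (As2N _ (As2_rat c))).1.
  by apply: BsN; apply: BsZ => //; apply: B_Bs.
apply: (@AsBs (iota e * (r * r) + iota (c - j * e) * r)).
  have -> : iota e * (r * r) + iota (c - j * e) * r =
    (iota j - r) * (d - iota c - iota e * r) +
    (r * d + iota (- j) * d + iota (j * c)) by ring.
  apply: AsD; first by apply: A_As; apply: mulA.
  by apply: proj1; apply: As2D (As2_rat _); apply: As2D => //; apply: As2Z.
by apply: BsD; apply: BsZ => //; apply: B_Bs => //; apply: mulB.
Qed.

(** * Slopes relative to an element of [Bs], and the Leibniz rule *)

Section Linear.
Variable t : K.
Hypothesis Bt : Bs t.

(** A lower bound [c] for the slope of [z]. Only [q] strictly below [c] is tested, so such bounds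
    pass to limits. *)
Definition Lower z (c : R) :=
  forall q : rat, ratr q < c -> Bs (z - iota q * t).

(* [z] has slope [c] in units of [t]: the value at [z] of the additive
   functional which [Bs] defines and which takes the value [1] at [t]. *)
Definition Slope z c := Lower z c /\ Lower (- z) (- c).

Lemma LowerD z w c d : Lower z c -> Lower w d -> Lower (z + w) (c + d).
Proof.
move=> zc wd q qcd.
have [p qp pc] : exists2 p : rat, ratr q - d < ratr p & ratr p < c.
  by apply: rat_between; rewrite ltrBlDr.
have -> : z + w - iota q * t = (z - iota p * t) + (w - iota (q - p) * t).
  by ring.
by apply: BsD; [apply: zc|apply: wd; rewrite rmorphB /=; lra].
Qed.

Lemma LowerZ s z c : 0 < s -> Lower z c -> Lower (iota s * z) (ratr s * c).
Proof.
move=> s0 zc q; have s0' : 0 < ratr s :> R by rewrite ltr0q.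
rewrite mulrC -(ltr_pdivrMr _ _ s0') -fmorph_div => /zc /(BsZ _ _ s0).
by rewrite mulrBr mulrA -rmorphM mulrCA divff ?gt_eqF // mulr1.
Qed.

Lemma Lower_lim z c : (forall e, 0 < e -> Lower z (c - e)) -> Lower z c.
Proof.
move=> zc q qc; apply: (zc ((c - ratr q) / 2)); first by apply: divr_gt0; lra.
lra.
Qed.

Lemma LowerW z c d : d <= c -> Lower z c -> Lower z d.
Proof. by move=> dc zc q qd; apply: zc; apply: lt_le_trans dc. Qed.

Lemma Lower_As z : As (- z) -> Lower z 0.
Proof.
move=> zA q; rewrite ltrq0 -oppr_gt0 => q0.
by rewrite addrC -mulNr -rmorphN; apply: BsDA => //; apply: BsZ.
Qed.

Lemma Lower_Bs z c : Lower z c -> 0 < c -> Bs z.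
Proof.
by move=> zc c0; have := zc 0; rewrite !rmorph0 mul0r subr0; apply.
Qed.

Lemma Lower_rat q : Lower (iota q) 0.
Proof. by apply: Lower_As; rewrite -rmorphN; apply: As_rat. Qed.

Lemma Slope_rat q : Slope (iota q) 0.
Proof.
by split; rewrite ?oppr0 -?rmorphN; apply: Lower_rat.
Qed.

Lemma Slope_t : Slope t 1.
Proof.
split=> q qc.
  rewrite -[X in Bs (X - _)]mul1r -mulrBl -(rmorph1 iota) -rmorphB.
  by apply: BsZ => //; rewrite subr_gt0 -(ltr_rat R) rmorph1.
rewrite -mulN1r -mulrBl -(rmorph1 iota) -rmorphN -rmorphB.
by apply: BsZ => //; rewrite subr_gt0 -(ltr_rat R) rmorphN rmorph1.
Qed.

Lemma SlopeN z c : Slope z c -> Slope (- z) (- c).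
Proof. by case=> ? ?; split; rewrite ?opprK. Qed.

Lemma SlopeD z w c d : Slope z c -> Slope w d -> Slope (z + w) (c + d).
Proof. by case=> ? ? [? ?]; split; rewrite ?opprD; apply: LowerD. Qed.

Lemma SlopeZ s z c : Slope z c -> Slope (iota s * z) (ratr s * c).
Proof.
have pos p y d : 0 < p -> Slope y d -> Slope (iota p * y) (ratr p * d).
  by move=> p0 [? ?]; split; rewrite -?mulrN; apply: LowerZ.
move=> zc; have [s0|s0|->] := ltgtP s 0.
- rewrite -mulrNN -rmorphN -(mulrNN (ratr s)) -rmorphN.
  by apply: pos; [lra|apply: SlopeN].
- exact: pos.
- by rewrite !rmorph0 !mul0r -(rmorph0 iota); apply: Slope_rat.
Qed.

Lemma Slope_Bs z c : Slope z c -> 0 < c -> Bs z.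
Proof. by case=> zc _; apply: Lower_Bs. Qed.

Lemma Slope_As z c : Slope z c -> c < 0 -> As z.
Proof.
by case=> _ zc c0; rewrite -[z]opprK; apply: BsN; apply: Lower_Bs zc _; lra.
Qed.

(** The product of [z + p] and [t - k], both in [B] and of small value, has slope at least [0];
    expanding it bounds the slope of [z t] below by [k c - p]. *)
Lemma Lower_mult_pos z c :
  Slope z c -> 0 < c -> Lower (z * t) (c * v t + v z).
Proof.
move=> zc c0; apply: Lower_lim => e e0.
(* Replacing [v t] by [k] and [- v z] by [p] costs at most [e / 2] each. *)
have [k kt tk] : exists2 k : rat, v t - e / 2 / c < ratr k & ratr k < v t.
  by apply: rat_between; rewrite gtrBl !divr_gt0.
have [p zp pz] : exists2 p : rat, - v z < ratr p & ratr p < - v z + e / 2.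
  by apply: rat_between; rewrite ltrDl divr_gt0.
have zB : B (z + iota p) by apply: Bs_B; [apply: Slope_Bs zc c0|lra].
have tB : B (t + iota (- k)) by apply: Bs_B => //; rewrite rmorphN /=; lra.
have -> : z * t = (z + iota p) * (t + iota (- k)) +
    (iota k * z + (iota (- p) * t + iota (p * k))) by ring.
have ck : c * v t - e / 2 < ratr k * c.
  by move: kt; rewrite -(ltr_pM2r c0) mulrBl divfK ?gt_eqF // mulrC.
apply: (@LowerW _ (0 + (ratr k * c + (ratr (- p) * 1 + 0)))).
  rewrite rmorphN /=; lra.
apply: LowerD; first by apply/Lower_As/BsN/B_Bs/mulB.
apply: LowerD; first exact: (SlopeZ _ _ _ zc).1.
by apply: LowerD (Lower_rat _); apply: (SlopeZ _ _ _ Slope_t).1.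
Qed.

(** The upper bound comes from the square of [j - t], which lies in [A] and so has slope at most
    [0], as [j] tends to [v t] from above. *)
Lemma Slope_sqr : Slope (t * t) (2 * v t).
Proof.
split.
  rewrite mulr_natl mulr2n -[X in X + _]mul1r.
  exact: Lower_mult_pos Slope_t _.
apply: Lower_lim => e e0.
have [j tj jt] : exists2 j : rat, v t < ratr j & ratr j < v t + e / 2.
  by apply: rat_between; rewrite ltrDl divr_gt0.
have tA : A (- t + iota j) by apply: As_A; [apply: BsN|rewrite rmorphN; lra].
have -> : - (t * t) = - ((- t + iota j) * (- t + iota j)) +
    (iota (- (2 * j)) * t + iota (j * j)) by ring.
apply: (@LowerW _ (0 + (ratr (- (2 * j)) * 1 + 0))).
  rewrite rmorphN rmorphM /= ratr_nat; lra.
apply: LowerD; first by apply: Lower_As; rewrite opprK; apply/A_As/mulA.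
by apply: LowerD (Lower_rat _); apply: (SlopeZ _ _ _ Slope_t).1.
Qed.

(** Adding a multiple [n t] makes the slope positive, so that [Lower_mult_pos] applies; [Slope_sqr]
    then removes [n t^2] exactly. The upper bound is the same argument for [- z]. *)
Lemma Slope_mult z c : Slope z c -> Slope (z * t) (c * v t + v z).
Proof.
have half y d : Slope y d -> Lower (y * t) (d * v t + v y).
  move=> yd; have [n dn _] : exists2 n : rat, - d < ratr n & ratr n < - d + 1.
    by apply: rat_between; rewrite ltrDl.
  have -> : y * t = (y + iota n * t) * t + iota (- n) * (t * t) by ring.
  apply: (@LowerW _ (((d + ratr n * 1) * v t + v (y + iota n * t)) +
                     ratr (- n) * (2 * v t))).
    rewrite rmorphD rmorphM v_iota rmorphN /=; lra.
  apply: LowerD; last exact: (SlopeZ _ _ _ Slope_sqr).1.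
  apply: Lower_mult_pos; last by lra.
  by apply: SlopeD yd _; apply: SlopeZ Slope_t.
move=> zc; split; first exact: half.
have := half _ _ (SlopeN _ _ zc).
by rewrite mulNr rmorphN mulNr opprD.
Qed.

Lemma Slope_affine z c u e : Slope z c ->
  Slope (z * (iota u + iota e * t))
        (c * (ratr u + ratr e * v t) + ratr e * v z).
Proof.
move=> zc; have -> : z * (iota u + iota e * t) = iota u * z + iota e * (z * t).
  by ring.
have -> : c * (ratr u + ratr e * v t) + ratr e * v z =
  ratr u * c + ratr e * (c * v t + v z) by ring.
by apply: SlopeD; apply: SlopeZ => //; apply: Slope_mult.
Qed.

(** Horner induction with the Leibniz rule. Slopes are measured against [t] while [p] is evaluated
    at [e t], hence the chain-rule factor [e]. *)
Lemma Slope_poly (p : {poly rat}) e :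
  Slope (map_poly iota p).[iota e * t]
        (ratr e * (map_poly ratr p^`()).[v (iota e * t)]).
Proof.
have e_mult z c : Slope z c ->
    Slope (z * (iota e * t)) (c * v (iota e * t) + ratr e * v z).
  move=> zc; have := Slope_affine _ _ 0 e zc.
  by rewrite !rmorph0 !add0r rmorphM v_iota.
move: (iota e * t) e_mult => w e_mult.
elim/poly_ind: p => [|p c IH].
  by rewrite deriv0 !rmorph0 !horner0 mulr0 -(rmorph0 iota); apply: Slope_rat.
rewrite derivD derivC addr0 derivM derivX mulr1.
rewrite !rmorphD !rmorphM /= !map_polyX map_polyC !hornerE /=.
have -> : (map_poly ratr p).[v w] = v (map_poly iota p).[w].
  rewrite -horner_map /= -map_poly_comp; congr (_.[_]).
  by apply: eq_map_poly => q /=; rewrite v_iota.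
rewrite mulrDr mulrA -[X in Slope _ X]addr0.
exact: SlopeD (e_mult _ _ IH) (Slope_rat _).
Qed.

(** If [r] were in [A], take an affine [m] of positive value for which [d m] has negative and
    [r d m] positive slope: then [d m], and so [r d m], is in [A], but the slope puts [r d m] in
    [B]. *)
Lemma Slope_quotient_B r d N' D' : Slope d D' -> Slope (r * d) N' ->
  0 < v r -> 0 < v d -> v (r * d) * D' < N' * v d -> B r.
Proof.
move=> dD nN r0 d0 ND; apply: notA_B => // Ar.
have n0 : 0 < v (r * d) by rewrite rmorphM mulr_gt0.
have [u [c [m0 mN mD]]] := affine_separation _ (v t) _ _ _ _ n0 d0 ND.
have vm : v (iota u + iota c * t) = ratr u + ratr c * v t.
  by rewrite rmorphD rmorphM !v_iota.
have dA : A (d * (iota u + iota c * t)).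
  apply: As_A0; last by rewrite rmorphM vm mulr_gt0.
  by apply: Slope_As mD; apply: Slope_affine.
apply: (disj (mulA _ _ Ar dA)); rewrite mulrA.
apply: Bs_B0; last by rewrite rmorphM vm mulr_gt0.
by apply: Slope_Bs mN; apply: Slope_affine.
Qed.

(** If [r] were in [B], then [r^-1] would be too by the previous lemma, and so would
    [r r^-1 = 1]. *)
Lemma Slope_quotient_A r d N' D' : Slope d D' -> Slope (r * d) N' ->
  0 < v r -> 0 < v d -> N' * v d < v (r * d) * D' -> A r.
Proof.
move=> dD nN r0 d0 ND; apply: notB_A => // Br.
have rn0 : r != 0 by apply: contraTneq r0 => ->; rewrite rmorph0 ltxx.
apply: (disj oneA); rewrite -(divff rn0); apply: mulB => //.
apply: (Slope_quotient_B _ _ _ _ nN); rewrite ?mulKf //.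
- exact: dD.
- by rewrite fmorphV invr_gt0.
- by rewrite rmorphM mulr_gt0.
- by rewrite mulrC [D' * _]mulrC.
Qed.

End Linear.

(** * Fields generated by a single element *)

Lemma As2_poly x (p : {poly rat}) : As2 x -> As2 (map_poly iota p).[x].
Proof.
move=> x2; elim/poly_ind: p => [|p c IH].
  by rewrite rmorph0 horner0 -(rmorph0 iota); apply: As2_rat.
rewrite rmorphD rmorphM /= map_polyX map_polyC !hornerE /=.
by apply: As2D (As2_rat _); apply: As2M.
Qed.

(** [gen] says that [x] generates [K], with denominators made positive; [w] is the numerator in the
    quotient rule for [n / d]. *)
Lemma split_dichotomy x : (exists b, B b) ->
    (forall r, exists n d : {poly rat}, 0 < v (map_poly iota d).[x] /\
       r * (map_poly iota d).[x] = (map_poly iota n).[x]) ->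
  exists2 e : rat, e = 1 \/ e = -1 &
  forall r (n d : {poly rat}), 0 < v r -> 0 < v (map_poly iota d).[x] ->
    r * (map_poly iota d).[x] = (map_poly iota n).[x] ->
    let w := (map_poly ratr n^`()).[v x] * v (map_poly iota d).[x] -
             v (map_poly iota n).[x] * (map_poly ratr d^`()).[v x] in
    (0 < ratr e * w -> B r) /\ (ratr e * w < 0 -> A r).
Proof.
move=> [b Bb] gen.
have [e [t [e1 Bt xt]]] :
    exists e t, [/\ e = 1 \/ e = -1, Bs t & x = iota e * t].
  have [x1|Bx] := As_or_Bs x; last first.
    by exists 1, x; split; rewrite ?rmorph1 ?mul1r //; left.
  have [x2|Bx] := As_or_Bs (- x); last first.
    by exists (-1), (- x); split; rewrite ?rmorphN1 ?mulN1r ?opprK //; right.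
  (* Here [x] is in [As2], hence so is every polynomial in [x]; as a quotient of two of them, [b]
     falls into [A]. *)
  have [n [d [d0 bd]]] := gen b.
  case: (@disj b) => //; apply: (As2_quotient _ _ _ d0); first exact: posB.
    exact: As2_poly.
  by rewrite bd; apply: As2_poly.
exists e => // r n d r0 d0 rd /=.
have nS := Slope_poly _ Bt n e; have dS := Slope_poly _ Bt d e.
rewrite -xt in nS dS; rewrite -rd in nS.
rewrite -rd mulrBr; split=> we.
  by apply: (Slope_quotient_B _ Bt _ _ _ _ dS nS r0 d0); lra.
by apply: (Slope_quotient_A _ Bt _ _ _ _ dS nS r0 d0); lra.
Qed.

End Split.

(** * Polynomials with vanishing Wronskian *)

Lemma lead_coef_deriv (F : numDomainType) (p : {poly F}) :
  lead_coef p^`() = lead_coef p *+ (size p).-1.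
Proof.
have [p1|p1] := leqP (size p) 1.
  (* For constants, zero included, [(size p).-1] is [0]. *)
  by rewrite [p]size1_polyC // derivC lead_coef0 size_polyC; case: eqP.
have sp : size p^`() = (size p).-1.
  rewrite /deriv size_poly_eq // prednK ?subn1 ?ltn_predRL //.
  rewrite mulrn_eq0 -lead_coefE negb_or lead_coef_eq0 -size_poly_gt0.
  by rewrite (ltn_trans _ p1) // -lt0n -subn1 subn_gt0 p1.
rewrite /lead_coef sp coef_deriv; case: (size p) p1 => [|[|m]] //.
Qed.

(** The leading coefficients of the two sides are [lead_coef n * lead_coef d] times the degree of
    [n], respectively of [d], and characteristic zero lets these degrees be compared. *)
Lemma size_wronskian0 (F : numDomainType) (n d : {poly F}) :
  n != 0 -> d != 0 -> n^`() * d = n * d^`() -> size n = size d.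
Proof.
move=> n0 d0 /(congr1 lead_coef).
rewrite !lead_coefM !lead_coef_deriv mulrnAl mulrnAr => /eqP.
rewrite -subr_eq0 -[X in X - _]mulr_natr -[X in _ - X]mulr_natr -mulrBr.
rewrite !mulf_eq0 !lead_coef_eq0 (negPf n0) (negPf d0) subr_eq0 eqr_nat /=.
move=> /eqP e; rewrite -(prednK (n := size n)) ?size_poly_gt0 // e.
by rewrite prednK ?size_poly_gt0.
Qed.

(** With [c] cancelling the leading terms, [n - c d] still has zero Wronskian with [d]; if nonzero
    it would have the size of [d], but its coefficient in that degree is zero. *)
Lemma wronskian0 (F : numFieldType) (n d : {poly F}) :
  d != 0 -> n^`() * d = n * d^`() -> exists c, n = c *: d.
Proof.
move=> d0 w; have [->|n0] := eqVneq n 0; first by exists 0; rewrite scale0r.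
have snd := size_wronskian0 _ _ _ n0 d0 w.
have ld0 : lead_coef d != 0 by rewrite lead_coef_eq0.
set c := lead_coef n / lead_coef d; exists c; apply/eqP; rewrite -subr_eq0.
apply/negPn/negP => m0.
have sm : size (n - c *: d) = size d.
  apply: size_wronskian0 => //.
  by rewrite derivB derivZ mulrBl mulrBl w -!scalerAl [d^`() * d]mulrC.
have := lead_coef_eq0 (n - c *: d); rewrite (negPf m0) lead_coefE sm.
rewrite coefB coefZ -lead_coefE -snd -lead_coefE /c divfK //.
by rewrite subrr eqxx.
Qed.

(** * Numerators and denominators of rational functions *)

Local Notation "p %:F" := (tofrac p).

Lemma fden_neq0 (r : ratfun) : fden r != 0.
Proof. exact: denom_ratioP. Qed.

(** [fnum] and [fden] belong to a chosen representative, not to a reduced fraction; this identity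
    links them to the field operations. *)
Lemma tofrac_fden (r : ratfun) : r * (fden r)%:F = (fnum r)%:F.
Proof.
rewrite /fnum /fden -[X in X * _](reprK r); unlock tofrac.
rewrite -[LHS]FracField.pi_mul; apply/eqmodP.
rewrite /= FracField.equivfE /FracField.mulf /=.
by rewrite !numden_Ratio ?mulf_neq0 ?oner_neq0 ?denom_ratioP // !mulr1 mulrC.
Qed.

(** * Evaluation and derivative at a transcendental point *)

Section Evaluation.
Variables (R : realType) (a : R).
Hypothesis htr : transcendental a.

Lemma pevalD : {morph peval a : p q / p + q}.
Proof. by move=> p q; rewrite /peval rmorphD hornerD. Qed.

Lemma pevalB : {morph peval a : p q / p - q}.
Proof. by move=> p q; rewrite /peval rmorphB hornerD hornerN. Qed.

Lemma pevalM : {morph peval a : p q / p * q}.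
Proof. by move=> p q; rewrite /peval rmorphM hornerM. Qed.

Lemma pevalC c : peval a c%:P = ratr c.
Proof. by rewrite /peval map_polyC hornerC. Qed.

Lemma pevalX : peval a 'X = a.
Proof. by rewrite /peval map_polyX hornerX. Qed.

Lemma peval_eq0 p : peval a p = 0 -> p = 0.
Proof. by move=> p0; apply/eqP/negPn/negP => /htr; rewrite p0 eqxx. Qed.

Lemma fden0 r : peval a (fden r) != 0.
Proof. exact/htr/fden_neq0. Qed.

Lemma cross_fnum r n d : r * d%:F = n%:F -> n * fden r = fnum r * d.
Proof.
move=> rd; apply/eqP; rewrite -tofrac_eq !rmorphM /= -rd -tofrac_fden.
by apply/eqP; ring.
Qed.

(** Independence of the representative: sums and products can be evaluated over a common
    denominator, whatever [repr] returns for them. *)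
Lemma feval_quotient {r n d} : d != 0 -> r * d%:F = n%:F ->
  feval a r = peval a n / peval a d.
Proof.
move=> /htr d0 /cross_fnum/(congr1 (peval a)); rewrite !pevalM => e.
by apply/eqP; rewrite /feval eqr_div ?fden0 //; apply/eqP; rewrite -e mulrC.
Qed.

Lemma fderiv_quotient {r n d} : d != 0 -> r * d%:F = n%:F ->
  fderiv_at a r = peval a (n^`() * d - n * d^`()) / peval a d ^+ 2.
Proof.
move=> /htr d0 /cross_fnum e.
have := congr1 (peval a) e; have := congr1 (fun p => peval a p^`()) e.
rewrite /fderiv_at !derivM !(pevalB, pevalD, pevalM) => e1 e0.
have r0 := fden0 r; apply/eqP; rewrite eqr_div ?expf_neq0 //; apply/eqP.
move: e0 e1.
move: (peval a n) (peval a n^`()) (peval a d) (peval a d^`()) d0 r0.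
move: (peval a (fnum r)) (peval a (fnum r)^`()).
move: (peval a (fden r)) (peval a (fden r)^`()) => s s' m m' x x' y y' y0 s0 e0.
(* [x] and [x'], the values of [n] and [n'], are eliminated through the cross relation and its
   derivative. *)
have -> : x = m * y / s by rewrite -e0 mulfK.
move=> e1; have -> : x' = (m' * y + m * y' - m * y / s * s') / s.
  by rewrite -e1 addrK mulfK.
by field.
Qed.

Lemma common_den_neq0 r s : fden r * fden s != 0.
Proof. by rewrite mulf_neq0 ?fden_neq0. Qed.

Lemma addr_num r s :
  (r + s) * (fden r * fden s)%:F = (fnum r * fden s + fnum s * fden r)%:F.
Proof.
by rewrite rmorphD !rmorphM /= -!tofrac_fden; ring.
Qed.

Lemma mulr_num r s : (r * s) * (fden r * fden s)%:F = (fnum r * fnum s)%:F.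
Proof. by rewrite !rmorphM /= -!tofrac_fden; ring. Qed.

Lemma fevalD r s : feval a (r + s) = feval a r + feval a s.
Proof.
rewrite (feval_quotient (common_den_neq0 r s) (addr_num r s)) /feval.
by rewrite !(pevalD, pevalM); field; rewrite !fden0.
Qed.

Lemma fevalM r s : feval a (r * s) = feval a r * feval a s.
Proof.
rewrite (feval_quotient (common_den_neq0 r s) (mulr_num r s)) /feval.
by rewrite !pevalM; field; rewrite !fden0.
Qed.

Lemma fderivD r s : fderiv_at a (r + s) = fderiv_at a r + fderiv_at a s.
Proof.
rewrite (fderiv_quotient (common_den_neq0 r s) (addr_num r s)) /fderiv_at.
rewrite !(derivD, derivM) !(pevalB, pevalD, pevalM).
by field; rewrite !fden0.
Qed.

Lemma fderivM r s :
  fderiv_at a (r * s) = fderiv_at a r * feval a s + feval a r * fderiv_at a s.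
Proof.
rewrite (fderiv_quotient (common_den_neq0 r s) (mulr_num r s)).
rewrite /fderiv_at /feval !derivM !(pevalB, pevalD, pevalM).
by field; rewrite !fden0.
Qed.

Lemma feval_tofrac p : feval a p%:F = peval a p.
Proof.
rewrite (feval_quotient (oner_neq0 _) (n := p)) ?rmorph1 ?mulr1 //.
by rewrite pevalC rmorph1 divr1.
Qed.

Lemma fderiv_tofrac p : fderiv_at a p%:F = peval a p^`().
Proof.
rewrite (fderiv_quotient (oner_neq0 _) (n := p)) ?rmorph1 ?mulr1 //.
by rewrite derivC mulr0 subr0 pevalC rmorph1 expr1n divr1.
Qed.

(** With the next lemma, this allows [feval a] to serve as the morphism [v] of the abstract part. *)
Lemma feval_is_zmod_morphism : zmod_morphism (feval a).
Proof.
have fN s : feval a (- s) = - feval a s.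
  rewrite -[- s]mul1r mulrN -mulNr fevalM -(rmorph1 (@tofrac {poly rat})).
  by rewrite -rmorphN feval_tofrac -rmorphN pevalC rmorphN rmorph1 mulN1r.
by move=> r s; rewrite fevalD fN.
Qed.

Lemma feval_is_monoid_morphism : monoid_morphism (feval a).
Proof.
split=> [|r s]; last exact: fevalM.
by rewrite -(rmorph1 (@tofrac {poly rat})) feval_tofrac pevalC rmorph1.
Qed.

HB.instance Definition _ := GRing.isZmodMorphism.Build ratfun R (feval a)
  feval_is_zmod_morphism.
HB.instance Definition _ := GRing.isMonoidMorphism.Build ratfun R (feval a)
  feval_is_monoid_morphism.

(** By transcendence, a Wronskian that vanishes at [a] is the zero polynomial, so [wronskian0]
    applies. *)
Lemma fderiv_eq0 r : fderiv_at a r = 0 -> exists c : rat, r = c%:P%:F.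
Proof.
have d0 : (fden r)%:F != 0 by rewrite tofrac_eq0 fden_neq0.
move=> /eqP; rewrite mulf_eq0 invr_eq0 expf_eq0 (negPf (fden0 r)) andbF orbF.
move=> /eqP/peval_eq0/eqP; rewrite subr_eq0 => /eqP/wronskian0[|c e].
  exact: fden_neq0.
exists c; apply: (mulIf d0).
by rewrite tofrac_fden e -mul_polyC rmorphM.
Qed.

Lemma map_poly_tofrac (p : {poly rat}) :
  (map_poly (@tofrac {poly rat} \o polyC) p).['X%:F] = p%:F.
Proof.
by rewrite map_poly_comp horner_map /= -/(comp_poly 'X p) comp_polyXr.
Qed.

(** * Every good split is one of the two *)

Lemma good_splitC (A B : ratfun -> Prop) :
  good_split a A B -> good_split a B A.
Proof.
move=> [cover disj [exA exB] [clA clB]]; split=> // r.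
  by rewrite cover; split=> -[]; auto.
by move=> [? ?]; apply: (disj r).
Qed.

Lemma good_split_signs (A B : ratfun -> Prop) : good_split a A B -> A 1 ->
  exists2 e : rat, e = 1 \/ e = -1 &
  forall r, Qpos a r ->
    (0 < ratr e * fderiv_at a r -> B r) /\ (ratr e * fderiv_at a r <= 0 -> A r).
Proof.
move=> [cover disj [_ exB] [[addA mulA] [addB mulB]]] A1.
pose iota := @tofrac {poly rat} \o polyC.
have disj' z : A z -> B z -> False by move=> Az Bz; apply: (disj z).
(* Extending the fraction by [fden r] turns the denominator into a square, positive at [a]. *)
have pos_den r : 0 < peval a (fden r * fden r).
  by rewrite pevalM -expr2 exprn_even_gt0 //= fden0.
have num_den r : r * (fden r * fden r)%:F = (fnum r * fden r)%:F.
  by rewrite !rmorphM mulrA /= tofrac_fden.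
have [r|e e1 sgn] := @split_dichotomy R ratfun (feval a) iota A B cover disj'
    addA mulA addB mulB A1 'X%:F exB.
  exists (fnum r * fden r), (fden r * fden r).
  by rewrite !map_poly_tofrac /= feval_tofrac.
exists e => // r r0.
have := sgn r (fnum r * fden r) (fden r * fden r) r0.
rewrite !map_poly_tofrac /= !feval_tofrac pevalX -!/(peval a _).
move=> /(_ (pos_den r) (num_den r)) [sB sA].
(* The [w] of [split_dichotomy] is the derivative times a positive square, so both have the same
   sign. *)
have fE : fderiv_at a r * peval a (fden r * fden r) ^+ 2 =
    peval a (fnum r * fden r)^`() * peval a (fden r * fden r) -
    peval a (fnum r * fden r) * peval a (fden r * fden r)^`().
  rewrite (fderiv_quotient _ (num_den r)) ?mulf_neq0 ?fden_neq0 //.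
  by rewrite divfK ?expf_neq0 ?gt_eqF // pevalB !pevalM.
rewrite -fE mulrA in sB sA.
have d2 : 0 < peval a (fden r * fden r) ^+ 2 by rewrite exprn_gt0.
rewrite (pmulr_lgt0 _ d2) in sB; rewrite (pmulr_llt0 _ d2) in sA.
split=> //; rewrite le_eqVlt => /orP[|//].
(* In the equality case [e] is nonzero, so the derivative vanishes and [r] is a positive rational
   constant, which lies in [A]. *)
rewrite mulf_eq0 fmorph_eq0 => /orP[|/eqP/fderiv_eq0[c rc]].
  by case: e1 => ->.
rewrite rc; apply: (@rat_inA R ratfun (feval a) iota A B) => //.
by rewrite -(ltr0q R) -pevalC -feval_tofrac -rc.
Qed.

(** The part without [1] is [Hp] for [e = 1] and [Hm] for [e = -1]; constants, and with them [H0],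
    go with [1]. *)
Lemma good_split_unit (A B : ratfun -> Prop) : good_split a A B -> A 1 ->
  same_set A (fun r => Hp a r \/ H0 a r) /\ same_set B (Hm a) \/
  same_set B (Hp a) /\ same_set A (fun r => H0 a r \/ Hm a r).
Proof.
move=> split_AB A1; have [e e1 sgn] := good_split_signs _ _ split_AB A1.
case: split_AB => cover disj _ _.
have posA r : A r -> Qpos a r by move=> Ar; apply/cover; left.
have posB r : B r -> Qpos a r by move=> Br; apply/cover; right.
case: e1 sgn => -> sgn; [right|left]; split=> r; split.
- move=> Br; have r0 := posB r Br; split=> //; rewrite ltNge; apply/negP => f0.
  by apply: (disj r); split=> //; apply: (sgn r r0).2; rewrite rmorph1 mul1r.
- by move=> [r0 f0]; apply: (sgn r r0).1; rewrite rmorph1 mul1r.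
- move=> Ar; have r0 := posA r Ar; have [f0|f0|f0] := ltgtP (fderiv_at a r) 0.
  + by right.
  + case: (disj r); split=> //; apply: (sgn r r0).1.
    by rewrite rmorph1 mul1r.
  + by left.
- by move=> [[r0 f0]|[r0 f0]]; apply: (sgn r r0).2;
    rewrite rmorph1 mul1r ?f0 // ltW.
- move=> Ar; have r0 := posA r Ar; have [f0|f0|f0] := ltgtP (fderiv_at a r) 0.
  + case: (disj r); split=> //; apply: (sgn r r0).1.
    by rewrite rmorphN1 mulN1r oppr_gt0.
  + by left.
  + by right.
- by move=> [[r0 f0]|[r0 f0]]; apply: (sgn r r0).2;
    rewrite rmorphN1 mulN1r oppr_le0 ?f0 // ltW.
- move=> Br; have r0 := posB r Br; split=> //; rewrite ltNge; apply/negP => f0.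
  by apply: (disj r); split=> //; apply: (sgn r r0).2;
    rewrite rmorphN1 mulN1r oppr_le0.
- by move=> [r0 f0]; apply: (sgn r r0).1; rewrite rmorphN1 mulN1r oppr_gt0.
Qed.

(** * Both splits are good *)

Lemma good_split_same_set (A A' B B' : ratfun -> Prop) :
  same_set A A' -> same_set B B' -> good_split a A' B' -> good_split a A B.
Proof.
move=> eA eB [cover disj [[x Ax] [y By]] [[addA mulA] [addB mulB]]].
split.
- by move=> r; rewrite cover eA eB.
- by move=> r; rewrite eA eB; apply: disj.
- by split; [exists x; rewrite eA|exists y; rewrite eB].
- by split; split=> r s; rewrite ?eA ?eB; auto.
Qed.

Lemma QposD r s : Qpos a r -> Qpos a s -> Qpos a (r + s).
Proof. by rewrite /Qpos fevalD; apply: addr_gt0. Qed.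

Lemma QposM r s : Qpos a r -> Qpos a s -> Qpos a (r * s).
Proof. by rewrite /Qpos fevalM; apply: mulr_gt0. Qed.

Lemma exists_Hp : exists r, Hp a r.
Proof.
have [q qa _] : exists2 q : rat, - a < ratr q & ratr q < - a + 1.
  by apply: rat_between; rewrite ltrDl.
exists ('X + q%:P)%:F; split; rewrite /Qpos ?feval_tofrac ?fderiv_tofrac.
  by rewrite pevalD pevalX pevalC; lra.
by rewrite derivD derivX derivC addr0 pevalC rmorph1.
Qed.

Lemma exists_Hm : exists r, Hm a r.
Proof.
have [q qa _] : exists2 q : rat, a < ratr q & ratr q < a + 1.
  by apply: rat_between; rewrite ltrDl.
exists (q%:P - 'X)%:F; split; rewrite /Qpos ?feval_tofrac ?fderiv_tofrac.
  by rewrite pevalB pevalX pevalC; lra.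
by rewrite derivB derivX derivC sub0r -rmorphN pevalC rmorphN1 oppr_lt0.
Qed.

(** Closure under sums is additivity of the derivative, closure under products the Leibniz rule with
    positive values; the sign [e] treats both splits at once. *)
Lemma good_split_sign (e : R) : e = 1 \/ e = -1 ->
  good_split a (fun r => Qpos a r /\ 0 <= e * fderiv_at a r)
               (fun r => Qpos a r /\ e * fderiv_at a r < 0).
Proof.
have fM r s : e * fderiv_at a (r * s) =
    e * fderiv_at a r * feval a s + feval a r * (e * fderiv_at a s).
  by rewrite fderivM; ring.
move=> e1; split.
- move=> r; split=> [r0|[[]|[]] //].
  by case: (leP 0 (e * fderiv_at a r)) => f0; [left|right].
- by move=> r [[_ f0] [_]]; rewrite ltNge f0.
- have [x [x0 fx]] := exists_Hp; have [y [y0 fy]] := exists_Hm.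
  case: e1 => ->; split; [exists x|exists y|exists y|exists x]; split=> //; lra.
- split; split=> r s [r0 fr] [s0 fs].
  + by split; [apply: QposD|rewrite fderivD mulrDr; apply: addr_ge0].
  + split; first exact: QposM.
    by rewrite fM; apply: addr_ge0; apply: mulr_ge0 => //; apply: ltW.
  + by split; [apply: QposD|rewrite fderivD mulrDr; lra].
  + split; first exact: QposM.
    have frs : e * fderiv_at a r * feval a s < 0 by rewrite pmulr_llt0.
    have rfs : feval a r * (e * fderiv_at a s) < 0 by rewrite pmulr_rlt0.
    by rewrite fM; lra.
Qed.

Lemma good_split_HpH0 : good_split a (fun r => Hp a r \/ H0 a r) (Hm a).
Proof.
apply: good_split_same_set (good_split_sign 1 (or_introl erefl)) => r;
  rewrite mul1r //.
rewrite le_eqVlt; split=> [[[? f0]|[? f0]]|[? /orP[/eqP f0|f0]]].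
- by rewrite f0 orbT.
- by rewrite f0 eqxx.
- by right.
- by left.
Qed.

Lemma good_split_H0Hm : good_split a (fun r => H0 a r \/ Hm a r) (Hp a).
Proof.
apply: good_split_same_set (good_split_sign (-1) (or_intror erefl)) => r;
  rewrite mulN1r ?oppr_lt0 //.
rewrite oppr_ge0 le_eqVlt; split=> [[[? f0]|[? f0]]|[? /orP[/eqP f0|f0]]].
- by rewrite f0 eqxx.
- by rewrite f0 orbT.
- by left.
- by right.
Qed.

End Evaluation.

Theorem theorem2p2 (R : realType) (alpha : R) (htr : transcendental alpha)
    (A B : ratfun -> Prop) :
  good_split alpha A B <->
  [\/ same_set A (fun r => Hp alpha r \/ H0 alpha r) /\ same_set B (Hm alpha),
      same_set B (fun r => Hp alpha r \/ H0 alpha r) /\ same_set A (Hm alpha),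
      same_set A (Hp alpha) /\ same_set B (fun r => H0 alpha r \/ Hm alpha r)
    | same_set B (Hp alpha) /\ same_set A (fun r => H0 alpha r \/ Hm alpha r)].
Proof.
split=> [AB|[][eA eB]].
- have [cover _ _ _] := AB.
  have : Qpos alpha 1.
    by rewrite /Qpos (feval_is_monoid_morphism _ _ htr).1 ltr01.
  (* The part containing [1] may be either of the two; exchanging [A] and [B] turns the second case
     into the first. *)
  move=> /cover[A1|B1].
    by case: (good_split_unit _ _ htr _ _ AB A1); [constructor 1|constructor 4].
  have BA := good_splitC _ _ _ _ AB.
  by case: (good_split_unit _ _ htr _ _ BA B1); [constructor 2|constructor 3].
- exact: good_split_same_set eA eB (good_split_HpH0 _ _ htr).
- apply: good_splitC.
  exact: good_split_same_set eA eB (good_split_HpH0 _ _ htr).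
- apply: good_splitC.
  exact: good_split_same_set eB eA (good_split_H0Hm _ _ htr).
- apply: good_splitC.
  apply: good_split_same_set eA eB _; apply: good_splitC.
  exact: good_split_H0Hm.
Qed.
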